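(* For every fixed pair of integers $r\ge 2$ and $d\ge r+2$, $$f_{r}(d,s,\ldots,s)=\Theta_{d,r}(s^{r}\log s)\quad\text{as } s\to\infty;$$ that is, there are constants $c,C>0$ and $s_{0}$, depending only on $d$ and $r$, such that $c\,s^{r}\log s\le f_{r}(d,s,\ldots,s)\le C\,s^{r}\log s$ for every integer $s\ge s_{0}$.
   Context: A set in $\mathbb{R}^{d}$ is called $s$-convex if it is a union of at most $s$ convex sets. For integers $r\ge 2$, $d\ge 1$ and $s_{1},\ldots,s_{r}\ge 1$, let $f_{r}(d,s_{1},\ldots,s_{r})$ be the least integer $N$ with the following property: whenever $P\subseteq\mathbb{R}^{d}$ is finite and $|P|\ge N$, there is a partition $P=P_{1}\sqcup\cdots\sqcup P_{r}$ into nonempty parts such that every choice of $s_{i}$-convex sets $C_{i}\supseteq P_{i}$, $i\in[r]=\{1,\ldots,r\}$, satisfies $\bigcap_{i=1}^{r}C_{i}\ne\emptyset$. In $f_{r}(d,s,\ldots,s)$ the parameter $s$ is repeated $r$ times. *)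

(* Defs.v *)
From mathcomp Require Import all_boot all_order all_algebra finmap.
From mathcomp Require Import all_classical all_reals all_analysis.

Set Implicit Arguments.
Unset Strict Implicit.
Unset Printing Implicit Defensive.

Local Open Scope classical_set_scope.
Local Open Scope ring_scope.

(* "At most s" convex sets: the K i need not be distinct or nonempty. *)
Definition s_convex (R : realType) (d s : nat) (C : set 'rV[R]_d) : Prop :=
  exists K : 'I_s -> set 'rV[R]_d,
    (forall i, convex_set (K i)) /\ C = \bigcup_i K i.

(* The library's [partition] requires the parts to be pairwise disjoint, to be
   nonempty and to cover. *)
Definition tverberg_property (R : realType) (r d : nat) (s : 'I_r -> nat)
    (N : nat) : Prop :=
  forall P : {fset 'rV[R]_d}, (N <= #|` P|)%N ->
  exists Q : 'I_r -> set 'rV[R]_d,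
    partition [set: 'I_r] Q [set` P] /\
    forall C : 'I_r -> set 'rV[R]_d,
      (forall i, s_convex (s i) (C i)) -> (forall i, Q i `<=` C i) ->
      \bigcap_i C i !=set0.

(* [is_tverberg_number R d s N] is f_r(d, s_1, ..., s_r) = N.  It is a relation,
   so that no value is attached to parameters for which no N has the property. *)
Definition is_tverberg_number (R : realType) (r d : nat) (s : 'I_r -> nat)
    (N : nat) : Prop :=
  tverberg_property R d s N /\
  forall M : nat, tverberg_property R d s M -> (N <= M)%N.

(* Main.v *)
Require Import Defs.
From mathcomp Require Import all_boot all_order all_algebra.
From mathcomp Require Import all_classical all_reals all_analysis.
From mathcomp Require Import fintype finset finmap ring lra zify.

Set Implicit Arguments.
Unset Strict Implicit.
Unset Printing Implicit Defensive.

Import Order.TTheory GRing.Theory Num.Theory.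

Local Open Scope ring_scope.

(** The order s^r log s is a count of halfspaces: a colouring that violates the
property is described by O(s^r) affine separations, each carrying O(log N) bits
on N points, and conversely s^r affine separations can be made to encode
s^r log s independent bits.

Upper bound.  Suppose that a colouring of N points in r colours is bad: each
colour class i splits into s pieces such that for every choice J of one piece per
class the convex hulls have no common point.  Sarkaria's tensor trick and Gordan's
alternative ([gordan], [convex_common_point_or_separation]) turn this into r affine
functions with sum 0, the i-th one positive on the chosen piece of class i.  What
is kept of them is the set of pairs (point, colour) at which they are positive; by
the Sauer-Shelah bound ([card_positive_parts]) there are at most
(N r + 1)^(r (d + 1)) such sets.  The s^r sets belonging to a bad colouring confine
every point to r - 1 colours ([card_allowed_colors]), because r numbers with sum 0
are not all positive.  Hence there are at most
(N r + 1)^(r (d + 1) s^r) (r - 1)^N bad colourings, fewer than r^N as soon as N is a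
large multiple of s^r log s ([certificates_beat_entropy]).

Lower bound.  A set all of whose colourings are bad, with affine witnesses, is
called avoiding below.  In the plane there are m 2^(m-1) axis-parallel ellipses such
that every subfamily is hit exactly by some 2^m points ([ellipse_system_exists]).
Whether a point lies in an ellipse is an affine condition in four parameters of the
ellipse, so this gives s log s points of dimension 4, up to a constant, every subset
of which is cut out by a union of s halfspaces; moreover all these halfspaces lie
above non-vertical hyperplanes or all below.  Thanks to that, s copies of such a
set can be placed along a parabola so that the halfspaces made for one copy contain
all other copies ([avoiding_clusters]): the s pieces of one colour are then separated
copy by copy, those of the others inside each copy.  This multiplies the size by s
and gives s^2 log s points for r = 2, d = 4.  Laying an avoiding set for r colours
in a hyperplane of a space of one more dimension makes its separating functions
non-vertical while leaving room for one more colour ([avoiding_upper]), so the same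
placement leads from (r, d) to (r + 1, d + 1) with another factor s; hence the
condition d >= r + 2. *)

(** * Gordan's alternative *)

Lemma finite_ubound (R : realFieldType) (I : finType) (F : I -> R) :
  exists2 K : R, 0 < K & forall i, F i <= K.
Proof.
exists (1 + \sum_i `|F i|); first by rewrite ltr_pwDl ?ltr01 ?sumr_ge0.
move=> i; apply: le_trans (ler_norm _) _; rewrite (bigD1 i) //= addrCA lerDl.
by rewrite addr_ge0 ?ler01 // sumr_ge0.
Qed.


Lemma small_perturbation (R : realFieldType) (I : finType) (a b : I -> R) :
  (forall i, 0 < a i) ->
  exists2 e : R, 0 < e & forall i, 0 < a i + e * b i.
Proof.
move=> a0; have [K K0 FK] := finite_ubound (fun i => - b i / a i).
have K1 : 0 < K + 1 by rewrite addr_gt0.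
exists (K + 1)^-1; first by rewrite invr_gt0.
move=> i; have := FK i; rewrite ler_pdivrMr // => bK.
rewrite -(pmulr_rgt0 _ K1) mulrDr mulVKf ?gt_eqF //.
by have := a0 i; lra.
Qed.

Definition dotp (R : comNzRingType) n (u v : 'rV[R]_n) : R := (u *m v^T) 0 0.

Lemma dotpDl (R : comNzRingType) n (u v w : 'rV[R]_n) :
  dotp (u + v) w = dotp u w + dotp v w.
Proof. by rewrite /dotp mulmxDl mxE. Qed.

Lemma dotpZl (R : comNzRingType) n a (u w : 'rV[R]_n) :
  dotp (a *: u) w = a * dotp u w.
Proof. by rewrite /dotp -scalemxAl mxE. Qed.

Lemma dotpDr (R : comNzRingType) n (u v w : 'rV[R]_n) :
  dotp u (v + w) = dotp u v + dotp u w.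
Proof. by rewrite /dotp linearD mulmxDr mxE. Qed.

Lemma dotpZr (R : comNzRingType) n a (u w : 'rV[R]_n) :
  dotp u (a *: w) = a * dotp u w.
Proof. by rewrite /dotp linearZ -scalemxAr mxE. Qed.

Lemma dotp_sumr (R : comNzRingType) n (I : finType) (u : 'rV[R]_n) (v : I -> 'rV[R]_n) :
  dotp u (\sum_i v i) = \sum_i dotp u (v i).
Proof. by rewrite /dotp linear_sum mulmx_sumr summxE. Qed.

Lemma dotp_gt0 (R : realFieldType) n (v : 'rV[R]_n) : v != 0 -> 0 < dotp v v.
Proof.
have E : dotp v v = \sum_i v 0 i ^+ 2.
  by rewrite /dotp mxE; apply: eq_bigr => i _; rewrite mxE expr2.
move=> v0; rewrite lt_neqAle E sumr_ge0 ?andbT => [|i _]; last exact: sqr_ge0.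
apply: contraNneq v0 => /esym/eqP; rewrite psumr_eq0 => [|i _]; last exact: sqr_ge0.
move=> /allP v0; apply/eqP/rowP => i; rewrite mxE.
by have := v0 i (mem_index_enum _); rewrite sqrf_eq0 => /eqP.
Qed.

(** Induction on the number of vectors, with no appeal to compactness.  Let y be
positive on all vectors but v0.  If y is negative on v0, project the other vectors
along v0 to the hyperplane orthogonal to y: a relation between the projections
lifts to one between the vectors, and a form positive on the projections can be
corrected by a multiple of y so as to vanish at v0, then tilted slightly.  If y
vanishes on v0, tilt it in the direction of v0. *)
Lemma gordan (R : realFieldType) (D n : nat) (v : 'I_n -> 'rV[R]_D) :
  (exists c : 'I_n -> R, [/\ forall i, 0 <= c i, exists i, 0 < c i &
     \sum_i c i *: v i = 0]) \/
  (exists y, forall i, 0 < dotp y (v i)).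
Proof.
elim: n v => [|n IHn] v; first by right; exists 0; case.
pose ext (c0 : R) (c : 'I_n -> R) (i : 'I_n.+1) := oapp c c0 (unlift ord0 i).
have ext0 c0 c : ext c0 c ord0 = c0 by rewrite /ext unlift_none.
have extS c0 c i : ext c0 c (lift ord0 i) = c i by rewrite /ext liftK.
have extP c0 c : 0 <= c0 -> (forall i, 0 <= c i) -> forall i, 0 <= ext c0 c i.
  by move=> c00 cP i; case: (unliftP ord0 i) => [j|] ->; rewrite ?ext0 ?extS.
have ext_sum c0 c : \sum_i ext c0 c i *: v i =
    c0 *: v ord0 + \sum_i c i *: v (lift ord0 i).
  by rewrite big_ord_recl ext0; congr (_ + _); apply: eq_bigr => i _; rewrite extS.
have allP0 y : 0 < dotp y (v ord0) -> (forall i, 0 < dotp y (v (lift ord0 i))) ->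
    forall i, 0 < dotp y (v i).
  by move=> y0 yS i; case: (unliftP ord0 i) => [j|] ->.
have [[c [c0 [i ci] sc]]|[y yv]] := IHn (fun i => v (lift ord0 i)).
  left; exists (ext 0 c); split; first exact: extP.
    by exists (lift ord0 i); rewrite extS.
  by rewrite ext_sum scale0r add0r.
have [py|py|py] := ltgtP 0 (dotp y (v ord0)).
- by right; exists y; apply: allP0.
- pose p := dotp y (v ord0).
  pose w i := v (lift ord0 i) - (dotp y (v (lift ord0 i)) / p) *: v ord0.
  have [[c [c0 [i ci] sc]]|[y' yw]] := IHn w.
    left; exists (ext (- \sum_i c i * (dotp y (v (lift ord0 i)) / p)) c); split.
    + apply: extP => //; rewrite -sumrN sumr_ge0 // => j _.
      by rewrite -mulrN mulr_ge0 // -mulrN -invrN divr_ge0 ?ltW // oppr_gt0.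
    + by exists (lift ord0 i); rewrite extS.
    + rewrite ext_sum -[RHS]sc scaleNr scaler_suml -sumrN -big_split /=.
      by apply: eq_bigr => j _; rewrite /w scalerBr scalerA addrC.
  right; pose z := y' - (dotp y' (v ord0) / p) *: y.
  have zv i : 0 < dotp z (v (lift ord0 i)).
    have := yw i; rewrite /w -scaleNr dotpDr dotpZr /z -scaleNr dotpDl dotpZl.
    by congr (0 < _); congr (_ + _); field; rewrite lt_eqF.
  have z0 : dotp z (v ord0) = 0.
    by rewrite /z -scaleNr dotpDl dotpZl -/p; field; rewrite lt_eqF.
  have [e e0 ez] := small_perturbation (fun i => - dotp y (v (lift ord0 i))) zv.
  exists (z - e *: y); apply: allP0 => [|i]; rewrite -scaleNr dotpDl dotpZl.
    by rewrite z0 add0r mulNr oppr_gt0 pmulr_rlt0.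
  by have := ez i; rewrite mulrN mulNr.
- have [v0|v0] := eqVneq (v ord0) 0.
    left; exists (ext 1 (fun=> 0)); split.
    + by apply: extP.
    + by exists ord0; rewrite ext0.
    + by rewrite ext_sum v0 scaler0 add0r big1 // => i _; rewrite scale0r.
  have [e e0 ey] := small_perturbation (fun i => dotp (v ord0) (v (lift ord0 i))) yv.
  right; exists (y + e *: v ord0); apply: allP0 => [|i]; rewrite dotpDl dotpZl //.
  by rewrite -py add0r mulr_gt0 ?dotp_gt0.
Qed.

(** * The Sauer-Shelah bound for positive halfspaces *)

Definition shattered (T : finType) (F : {set {set T}}) (A : {set T}) : bool :=
  [forall B : {set T}, (B \subset A) ==> [exists C in F, A :&: C == B]].

Lemma shatteredP (T : finType) (F : {set {set T}}) (A : {set T}) :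
  reflect (forall B : {set T}, B \subset A -> exists2 C, C \in F & A :&: C = B)
          (shattered F A).
Proof.
apply: (iffP forallP) => sh B.
  move=> BA; have /implyP/(_ BA)/exists_inP[C CF /eqP] := sh B.
  by exists C.
by apply/implyP => /sh[C CF CB]; apply/exists_inP; exists C => //; apply/eqP.
Qed.

(** Pajor's form of the Sauer-Shelah lemma.  Split F by a point x contained in
some but not all members.  A set shattered by one half is shattered by F, and a set
A shattered by both halves yields two sets shattered by F, namely A and x |: A; no
set shattered by a half contains x, so nothing is counted twice. *)
Lemma card_le_shattered (T : finType) (F : {set {set T}}) :
  (#|F| <= #|[set A | shattered F A]|)%N.
Proof.
have [n] := ubnP #|F|; elim: n F => // n IHn F; rewrite ltnS => Fn.
case: (pickP (fun x => [exists C in F, x \in C] && [exists C in F, x \notin C]))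
    => [x /andP[/exists_inP[C1 C1F xC1] /exists_inP[C0 C0F xC0]]|nox]; last first.
  have [->|[C CF]] := set_0Vmem F; first by rewrite cards0.
  have /subset_leq_card : F \subset [set C].
    apply/subsetP => C' C'F; rewrite inE; apply/eqP/setP => x.
    have := nox x; case: (boolP (x \in C')) => xC'; case: (boolP (x \in C)) => xC //.
      case/negP; apply/andP; split; apply/exists_inP;
        [by exists C' | by exists C].
    case/negP; apply/andP; split; apply/exists_inP;
      [by exists C | by exists C'].
  rewrite cards1 => /leq_trans -> //; rewrite card_gt0; apply/set0Pn.
  exists set0; rewrite inE; apply/shatteredP => B; rewrite subset0 => /eqP ->.
  by exists C => //; rewrite set0I.
pose F1 := F :&: [set C : {set T} | x \in C].
pose F0 := F :\: [set C : {set T} | x \in C].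
have EF : (#|F1| + #|F0| = #|F|)%N by rewrite cardsID.
have F1_gt0 : (0 < #|F1|)%N.
  by rewrite card_gt0; apply/set0Pn; exists C1; rewrite !inE C1F.
have F0_gt0 : (0 < #|F0|)%N.
  by rewrite card_gt0; apply/set0Pn; exists C0; rewrite !inE C0F xC0.
have IH1 := IHn F1 ltac:(lia); have IH0 := IHn F0 ltac:(lia).
set S1 := [set A | shattered F1 A] in IH1; set S0 := [set A | shattered F0 A] in IH0.
have xS1 A : A \in S1 -> x \notin A.
  rewrite inE => /shatteredP/(_ set0 (sub0set _))[C]; rewrite !inE => /andP[_ xC].
  by move=> /setP/(_ x); rewrite !inE xC andbT => ->.
have xS0 A : A \in S0 -> x \notin A.
  rewrite inE => /shatteredP/(_ A (subxx _))[C]; rewrite !inE => /andP[xC _].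
  by move=> /setP/(_ x); rewrite !inE (negbTE xC) andbF => <-.
have xS A : A \in S1 :|: S0 -> x \notin A by case/setUP => [/xS1|/xS0].
have inj : {in S1 :&: S0 &, injective (fun A => x |: A)}.
  move=> A B /setIP[/xS1 xA _] /setIP[/xS1 xB _] E.
  by rewrite -(setU1K xA) -(setU1K xB) E.
have dis : [disjoint S1 :|: S0 & [set x |: A | A in S1 :&: S0]].
  rewrite disjoints_subset; apply/subsetP => A /xS xA; rewrite inE.
  by apply/imsetP => -[B _ AB]; rewrite AB !inE eqxx in xA.
rewrite -EF; apply: leq_trans (leq_add IH1 IH0) _.
rewrite -cardsUI -(card_in_imset inj).
have -> : (#|S1 :|: S0| + #|[set x |: A | A in S1 :&: S0]| =
    #|(S1 :|: S0) :|: [set x |: A | A in S1 :&: S0]|)%N.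
  by apply/esym/eqP; rewrite (leq_card_setU _ _).2.
apply/subset_leq_card/subsetP => A; rewrite in_setU => /orP[/setUP AS|].
  rewrite inE; apply/shatteredP => B BA.
  by case: AS; rewrite inE => /shatteredP/(_ B BA)[C]; rewrite inE => CF CB;
    exists C => //; case/andP: CF.
case/imsetP => B /setIP[]; rewrite !inE => B1 B0 ->.
have xB : x \notin B by apply: xS1; rewrite inE.
apply/shatteredP => C CxB.
have CB : C :\ x \subset B by rewrite subDset.
have [xC|xC] := boolP (x \in C).
  have [E] := shatteredP _ _ B1 _ CB; rewrite !inE => /andP[EF' xE] BE.
  by exists E => //; rewrite setIUl BE (setIidPl _) ?sub1set // setD1K.
have [E] := shatteredP _ _ B0 _ CB; rewrite !inE => /andP[xE EF'] BE.
exists E => //; rewrite setIUl BE.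
have -> : [set x] :&: E = set0.
  by apply/setP => z; rewrite !inE; case: eqP => // ->; rewrite (negbTE xE).
rewrite set0U; apply/setP => z; rewrite !inE; case: eqP => // ->.
by rewrite (negbTE xC).
Qed.

Lemma card_small_sets (T : finType) (D : nat) :
  (#|[set A : {set T} | #|A| <= D]| <= #|T|.+1 ^ D)%N.
Proof.
pose g (f : {ffun 'I_D -> option T}) := [set t | Some t \in codom f].
have -> : (#|T|.+1 ^ D = #|[set: {ffun 'I_D -> option T}]|)%N.
  by rewrite cardsT card_ffun card_option card_ord.
apply: leq_trans (leq_imset_card g _).
apply/subset_leq_card/subsetP => A; rewrite inE cardE => AD.
apply/imsetP; exists [ffun i : 'I_D => nth None (map Some (enum A)) i] => //.
apply/setP => t; rewrite inE; apply/idP/codomP => [tA|[i]].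
  have iA : (index t (enum A) < size (enum A))%N by rewrite index_mem mem_enum.
  exists (Ordinal (leq_trans iA AD)).
  by rewrite ffunE (nth_map t) //= nth_index // mem_enum.
rewrite ffunE; have [iA|iA] := ltnP i (size (enum A)).
  by rewrite (nth_map t) // => -[->]; rewrite -mem_enum mem_nth.
by rewrite nth_default // size_map.
Qed.

Definition positive_part (R : realFieldType) (T : finType) D (v : T -> 'rV[R]_D)
  (y : 'rV[R]_D) : {set T} := [set t | 0 < dotp y (v t)].

(** More than D vectors of dimension D satisfy a linear relation with some positive
coefficient; a form that is positive exactly on the vectors with a positive
coefficient would make every term of that relation nonnegative and one positive. *)
Lemma shattered_positive_parts (R : realFieldType) (T : finType) D
    (v : T -> 'rV[R]_D) (F : {set {set T}}) (A : {set T}) :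
  (forall C, C \in F -> exists y, C = positive_part v y) ->
  shattered F A -> (#|A| <= D)%N.
Proof.
move=> FP /shatteredP sh; rewrite leqNgt; apply/negP => DA.
pose M : 'M[R]_(#|A|, D) := \matrix_i v (enum_val i).
have /rowV0Pn[c /sub_kermxP cM c0] : kermx M != 0.
  rewrite kermx_eq0 /row_free; apply: contraTneq DA => <-.
  by rewrite -leqNgt rank_leq_col.
(* A nonzero relation or its opposite has a positive coefficient. *)
wlog [i ci] : c cM c0 / exists i, 0 < c 0 i.
  move=> IH; have /rV0Pn[i ci] := c0.
  have [ci0|ci0|ci0] := ltgtP 0 (c 0 i); last by rewrite -ci0 eqxx in ci.
    by apply: (IH c) => //; exists i.
  apply: (IH (- c)); rewrite ?mulNmx ?cM ?oppr0 ?oppr_eq0 //.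
  by exists i; rewrite mxE oppr_gt0.
pose B := [set enum_val i | i in [set i | 0 < c 0 i]].
have BA : B \subset A.
  by apply/subsetP => t /imsetP[j _ ->]; apply: enum_valP.
have [C /FP[y ->] AB] := sh _ BA.
have yP j : (0 < dotp y (v (enum_val j))) = (0 < c 0 j).
  have /setP/(_ (enum_val j)) := AB; rewrite !inE enum_valP /= => ->.
  by rewrite mem_imset ?inE //; apply: enum_val_inj.
have : \sum_j c 0 j * dotp y (v (enum_val j)) = 0.
  transitivity (dotp y (c *m M)); last first.
    by rewrite cM /dotp trmx0 mulmx0 mxE.
  rewrite mulmx_sum_row dotp_sumr; apply: eq_bigr => j _.
  by rewrite dotpZr rowK.
have ge0 j : 0 <= c 0 j * dotp y (v (enum_val j)).
  have := yP j; case: ltP => [yj /esym cj|yj /esym/negbT].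
    by rewrite mulr_ge0 ?ltW.
  by rewrite -leNgt => cj; rewrite mulr_le0.
move/eqP; rewrite psumr_eq0 // => /allP/(_ i (mem_index_enum _)).
by rewrite /= mulf_eq0 !gt_eqF // yP.
Qed.

Lemma card_positive_parts (R : realFieldType) (T : finType) D
    (v : T -> 'rV[R]_D) (F : {set {set T}}) :
  (forall C, C \in F -> exists y, C = positive_part v y) ->
  (#|F| <= #|T|.+1 ^ D)%N.
Proof.
move=> FP; apply: leq_trans (card_le_shattered F) _.
apply: leq_trans (card_small_sets T D).
apply/subset_leq_card/subsetP => A; rewrite !inE.
exact: (shattered_positive_parts FP).
Qed.

(** * Separation of convex sets without a common point *)

(** The weights are not normalized, so that the lemma applies directly to the
coefficients of a linear relation. *)
Lemma convex_set_bary (R : realType) (d : nat) (K : set 'rV[R]_d) (I : eqType)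
    (s : seq I) (c : I -> R) (x : I -> 'rV[R]_d) :
  convex_set K -> (0 < size s)%N ->
  (forall i, i \in s -> 0 < c i /\ K (x i)) ->
  K ((\sum_(i <- s) c i)^-1 *: \sum_(i <- s) c i *: x i).
Proof.
move=> Kconv; elim: s => // i s IHs _ cK.
have [ci Ki] := cK i (mem_head _ _).
have cKs j : j \in s -> 0 < c j /\ K (x j).
  by move=> js; apply: cK; rewrite inE js orbT.
rewrite !big_cons; case: s IHs cKs {cK} => [_ _|j s IHs cKs].
  by rewrite !big_nil !addr0 scalerA mulVf ?scale1r ?gt_eqF.
set S := \sum_(k <- _) c k; set X := \sum_(k <- _) c k *: x k.
have S0 : 0 < S.
  rewrite /S big_cons ltr_pwDl //; first by have [] := cKs j (mem_head _ _).
  rewrite big_seq sumr_ge0 // => k ks.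
    by have [] := cKs k; rewrite ?inE ?ks ?orbT // => /ltW.
have cS0 : 0 < c i + S by rewrite addr_gt0.
have l0 : 0 <= c i / (c i + S) by rewrite divr_ge0 ?ltW.
have l1 : c i / (c i + S) <= 1 by rewrite ler_pdivrMr // mul1r lerDl ltW.
have := Kconv (x i) (S^-1 *: X) (Itv01 l0 l1).
rewrite !in_setE => /(_ Ki (IHs isT cKs)).
congr (K _); rewrite /conv /= scalerDr !scalerA.
congr (_ *: _ + _ *: _); first by field; rewrite gt_eqF.
by rewrite /unstable.onem; field; rewrite !gt_eqF.
Qed.

(** The vertices of a regular simplex centred at the origin: r vectors whose only
linear relations are those with constant coefficients. *)
Definition tensor_weight (R : realFieldType) (r : nat) (i : 'I_r) : 'rV[R]_r :=
  delta_mx 0 i - const_mx r%:R^-1.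

Definition homogenize (R : realFieldType) (d : nat) (x : 'rV[R]_d) : 'rV[R]_(d + 1) :=
  row_mx x 1%:M.

(** Sarkaria's embedding of a point of colour i.  The forms y on the tensor space
are the r-tuples of affine functions with sum 0, modulo forms that vanish on all
embedded points. *)
Definition sarkaria (R : realFieldType) (r d : nat) (i : 'I_r) (x : 'rV[R]_d) :
    'rV[R]_(r * (d + 1)) :=
  mxvec ((tensor_weight R i)^T *m homogenize x).

Lemma dotp_sarkaria_sum (R : realFieldType) (r d : nat) (x : 'rV[R]_d) y :
  \sum_(i < r) dotp y (sarkaria i x) = 0.
Proof.
case: r y => [|r] y; first by rewrite big_ord0.
rewrite -dotp_sumr -linear_sum -mulmx_suml -linear_sum.
have -> : \sum_i tensor_weight R i = 0 :> 'rV_r.+1.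
  apply/rowP => j; rewrite summxE mxE.
  under eq_bigr do rewrite !mxE eqxx.
  rewrite sumrB (bigD1 j) //= eqxx big1 => [|k]; last by rewrite eq_sym => /negbTE ->.
  by rewrite addr0 sumr_const card_ord -[X in 1 - X]mulr_natr mulVf ?subrr ?pnatr_eq0.
by rewrite linear0 mul0mx linear0 /dotp trmx0 mulmx0 mxE.
Qed.

(** Gordan's alternative for the embedded points.  Because the only relations between
the tensor weights have constant coefficients, a positive relation between embedded
points gives every colour the same mass and the same barycentre, which is a common
point of the convex sets. *)
Lemma convex_common_point_or_separation (R : realType) (r d n : nat)
    (x : 'I_n -> 'rV[R]_d) (color : 'I_n -> 'I_r) (K : 'I_r -> set 'rV[R]_d) :
  (forall i, convex_set (K i)) -> (forall t, K (color t) (x t)) ->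
  (exists p, forall i, K i p) \/
  (exists y, forall t, 0 < dotp y (sarkaria (color t) (x t))).
Proof.
move=> Kconv Kx.
have [[c [c0 [t1 ct1] sc]]|] := gordan (fun t => sarkaria (color t) (x t));
  last by right.
left.
have r0 : (0 < r)%N := leq_ltn_trans (leq0n _) (ltn_ord (color t1)).
have rR : r%:R != 0 :> R by rewrite pnatr_eq0 -lt0n.
have tens k l : \sum_t c t * (tensor_weight R (color t) 0 k * homogenize (x t) 0 l) = 0.
  have := congr1 (fun v : 'rV[R]_(r * (d + 1)) => v 0 (mxvec_index k l)) sc.
  rewrite summxE mxE => E; rewrite -[RHS]E; apply: eq_bigr => t _.
  by rewrite [RHS]mxE /sarkaria mxvecE [in RHS]mxE big_ord1 [in RHS]mxE.
have mass k l : \sum_(t | color t == k) c t * homogenize (x t) 0 l =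
    r%:R^-1 * \sum_t c t * homogenize (x t) 0 l.
  apply/eqP; rewrite -subr_eq0 -[X in _ == X](tens k l) mulr_sumr big_mkcond /=.
  rewrite -sumrB; apply/eqP/eq_bigr => t _; rewrite !mxE eqxx /= eq_sym.
  by case: ifP => _ /=; ring.
pose m := r%:R^-1 * \sum_t c t.
pose q := r%:R^-1 *: \sum_t c t *: x t.
have m0 : 0 < m.
  rewrite mulr_gt0 ?invr_gt0 ?ltr0n // (bigD1 t1) //= ltr_pwDl //.
  by rewrite sumr_ge0.
(* The coordinate added by the homogenization counts the mass of a colour. *)
have massE k : \sum_(t | color t == k) c t = m.
  have h t : c t * homogenize (x t) 0 (rshift d ord0) = c t.
    by rewrite /homogenize row_mxEr mxE eqxx mulr1.
  have := mass k (rshift d ord0).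
  by under eq_bigr do rewrite h; under [in X in _ = X -> _]eq_bigr do rewrite h.
have pointE k : \sum_(t | color t == k) c t *: x t = q.
  have h t j : c t * homogenize (x t) 0 (lshift 1 j) = (c t *: x t) 0 j.
    by rewrite /homogenize row_mxEl mxE.
  apply/rowP => j; have := mass k (lshift 1 j).
  under eq_bigr do rewrite h; under [in X in _ = X -> _]eq_bigr do rewrite h.
  by rewrite -!summxE => ->; rewrite [RHS]mxE.
exists (m^-1 *: q) => k.
(* Points of weight 0 are dropped, as [convex_set_bary] wants positive weights. *)
pose s := [seq t <- index_enum 'I_n | (color t == k) && (0 < c t)].
have pos_sum (V : lmodType R) (y : 'I_n -> V) :
    \sum_(t | color t == k) c t *: y t = \sum_(t <- s) c t *: y t.
  rewrite big_filter [LHS]big_mkcond [RHS]big_mkcond.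
  apply: eq_bigr => t _; case: (color t == k) => //=; case: ltP => // ct.
  by have -> : c t = 0 by [apply/eqP; rewrite eq_le ct c0]; rewrite scale0r.
have smass : \sum_(t <- s) c t = m.
  have := pos_sum R^o (fun=> 1); rewrite -(massE k) => E.
  transitivity (\sum_(t <- s) c t *: (1 : R^o)).
    by apply: eq_bigr => t _; rewrite /GRing.scale /= mulr1.
  by rewrite -E; apply: eq_bigr => t _; rewrite /GRing.scale /= mulr1.
rewrite -smass -(pointE k) pos_sum; apply: convex_set_bary => //.
  case: s smass {pos_sum} => //; rewrite big_nil => E.
  by rewrite -E ltxx in m0.
move=> t; rewrite mem_filter => /andP[/andP[/eqP tk ct] _]; split => //.
by rewrite -tk.
Qed.

(** * Counting bad colourings *)

Lemma card_family_le (T : finType) (S : finType) (B : T -> {set S}) (k : nat) :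
  (forall t, #|B t| <= k)%N ->
  (#|[set f : {ffun T -> S} | f \in family B]| <= k ^ #|T|)%N.
Proof.
move=> Bk; rewrite cardsE card_family [#|T|]cardE /image_mem.
by elim: (enum T) => //= t s IHs; rewrite expnS leq_mul.
Qed.

(** D J stands for the set of pairs (point, colour) at which the functions that
separate the pieces selected by J are positive.  Colour i is allowed at t if some
piece j of colour i could contain t without contradicting any of these sets. *)
Definition allowed_colors (r s : nat) (T : finType)
    (D : {ffun {ffun 'I_r -> 'I_s} -> {set T * 'I_r}}) (t : T) : {set 'I_r} :=
  [set i | [exists j, [forall J : {ffun 'I_r -> 'I_s},
                        (J i == j) ==> ((t, i) \in D J)]]].

(** If every colour were allowed, through pieces j, then the functions separating the
pieces selected by j would all be positive at x t, although their sum is 0. *)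
Lemma card_allowed_colors (R : realType) (r d s : nat) (T : finType)
    (x : T -> 'rV[R]_d) (D : {ffun {ffun 'I_r -> 'I_s} -> {set T * 'I_r}}) (t : T) :
  (0 < r)%N ->
  (forall J, exists y, D J = positive_part (fun p => sarkaria p.2 (x p.1)) y) ->
  (#|allowed_colors D t| <= r.-1)%N.
Proof.
move=> r0 DP; rewrite -ltnS (prednK r0).
suff /proper_card : allowed_colors D t \proper [set: 'I_r] by rewrite cardsT card_ord.
rewrite properT; apply/negP => /eqP all_allowed.
have /fin_all_exists[j jP] i : exists j, forall J : {ffun 'I_r -> 'I_s},
    J i = j -> (t, i) \in D J.
  have : i \in allowed_colors D t by rewrite all_allowed in_setT.
  rewrite inE => /existsP[j /forallP jP]; exists j => J Ji.
  by have /implyP := jP J; apply; rewrite Ji.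
have [y Dy] := DP (finfun j).
have pos i : 0 < dotp y (sarkaria i (x t)).
  have := jP i (finfun j); rewrite ffunE Dy inE; exact.
have : 0 < \sum_(i < r) dotp y (sarkaria i (x t)).
  rewrite (bigD1 (Ordinal r0)) //= ltr_pwDl ?pos // sumr_ge0 // => i _.
  exact/ltW.
by rewrite dotp_sarkaria_sum ltxx.
Qed.

Lemma certificate_of_bad_coloring (R : realType) (r d s : nat) (T : finType)
    (x : T -> 'rV[R]_d) (color : T -> 'I_r) (C : 'I_r -> set 'rV[R]_d) :
  (forall i, s_convex s (C i)) -> (forall t, C (color t) (x t)) ->
  (\bigcap_i C i)%classic = classical_sets.set0 ->
  exists D : {ffun {ffun 'I_r -> 'I_s} -> {set T * 'I_r}},
    (forall J, exists y, D J = positive_part (fun p => sarkaria p.2 (x p.1)) y) /\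
    (forall t, color t \in allowed_colors D t).
Proof.
move=> Cconv xC C0.
have /choice[K KP] := Cconv.
have /choice[lab labP] t : exists j, K (color t) j (x t).
  by have := xC t; have [_ ->] := KP (color t) => -[j _ Kj]; exists j.
have /fin_all_exists[y yP] (J : {ffun 'I_r -> 'I_s}) : exists y,
    forall t, J (color t) = lab t -> 0 < dotp y (sarkaria (color t) (x t)).
  pose A := [set t | J (color t) == lab t].
  have [||[p Kp]|[y yA]] := @convex_common_point_or_separation R r d #|A|
      (fun i => x (enum_val i)) (fun i => color (enum_val i)) (fun i => K i (J i)).
  - by move=> i; have [] := KP i.
  - by move=> i; have := enum_valP i; rewrite inE => /eqP ->; apply: labP.
  - have : (\bigcap_i C i)%classic p.
      by move=> i _; have [_ ->] := KP i; exists (J i).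
    by rewrite C0.
  - exists y => t Jt; have tA : t \in A by rewrite inE Jt.
    by have := yA (enum_rank_in tA t); rewrite enum_rankK_in.
exists [ffun J => positive_part (fun p => sarkaria p.2 (x p.1)) (y J)]; split.
  by move=> J; exists (y J); rewrite ffunE.
move=> t; rewrite inE; apply/existsP; exists (lab t); apply/forallP => J.
by apply/implyP => /eqP Jt; rewrite ffunE inE /=; apply: yP.
Qed.

(** The count bounds the pairs formed by a family D of positive parts and a
colouring that uses allowed colours only.  A colouring outside this list is good,
and its classes are automatically nonempty: an empty class could be covered by the
empty set. *)
Lemma tverberg_property_of_count (R : realType) (r d s N : nat) :
  (0 < r)%N -> (0 < s)%N ->
  (forall n, (N <= n)%N ->
     ((n * r).+1 ^ (r * (d + 1))) ^ (s ^ r) * r.-1 ^ n < r ^ n)%N ->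
  tverberg_property R d (fun _ : 'I_r => s) N.
Proof.
move=> r0 s0 count P NP.
have cardP : #|{: P}| = #|` P| by rewrite cardfE.
pose x (t : P) := val t.
pose Q (color : P -> 'I_r) i := [set p | exists2 t, color t = i & p = x t]%classic.
have [[color good]|bad] := pselect (exists color : P -> 'I_r,
    forall C : 'I_r -> set 'rV[R]_d,
    (forall i, s_convex s (C i)) -> (forall t, C (color t) (x t)) ->
    (\bigcap_i C i !=set0)%classic).
  exists (Q color); split; last first.
    by move=> C Cc QC; apply: good => // t; apply: QC; exists t.
  split.
  - apply/seteqP; split => [p [i _ [t _ ->]]|p /= pP]; first exact: valP.
    by exists (color [` pP]%fset) => //; exists [` pP]%fset.
  - move=> i j _ _ [p [[t <- ->] [t' <- E]]].
    by have -> : t = t' by apply: val_inj.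
  - move=> i _; apply: contrapT => Q0.
    have sC (b : bool) : s_convex s
        (if b then classical_sets.setT else classical_sets.set0 : set 'rV[R]_d).
      exists (fun=> if b then classical_sets.setT else classical_sets.set0); split => [_|].
        by case: b => // y z l; rewrite !in_setE.
      apply/seteqP; split => [p bp|p [_ _ //]].
      by exists (Ordinal s0).
    have [|t|p /(_ i I)] := good (fun j =>
        if j != i then classical_sets.setT else classical_sets.set0).
    + by move=> j; apply: sC.
    + by case: eqP => //= ti; case: Q0; exists (x t), t.
    + by rewrite eqxx.
have /fin_all_exists[D DP] (color : {ffun P -> 'I_r}) :
    exists D : {ffun {ffun 'I_r -> 'I_s} -> {set P * 'I_r}},
    (forall J, exists y, D J = positive_part (fun p => sarkaria p.2 (x p.1)) y) /\
    (forall t, color t \in allowed_colors D t).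
  apply: contrapT => noD; apply: bad; exists color => C Cc xC.
  apply: contrapT => /set0P/negP; rewrite negbK => /eqP C0; apply: noD.
  exact: certificate_of_bad_coloring C0.
pose Fam := [set A : {set P * 'I_r} |
  `[< exists y, A = positive_part (fun p => sarkaria p.2 (x p.1)) y >]].
have Fam_card : (#|Fam| <= (#|` P| * r).+1 ^ (r * (d + 1)))%N.
  have := @card_positive_parts R _ _ (fun p : P * 'I_r => sarkaria p.2 (x p.1)) Fam.
  rewrite card_prod card_ord cardP; apply => A.
  by rewrite inE => /asboolP.
have DFam color : D color \in ffun_on (mem Fam).
  apply/ffun_onP => J; rewrite inE; apply/asboolP; exact: (DP color).1.
exfalso; have := count _ NP; rewrite ltnNge => /negP; apply.
have -> : (r ^ #|` P| = #|[set: {ffun P -> 'I_r}]|)%N.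
  by rewrite cardsT card_ffun card_ord cardP.
rewrite -sum1_card (partition_big D (mem (ffun_on (mem Fam)))) /=; last first.
  by move=> color _; apply: DFam.
apply: leq_trans (_ : \sum_(E in ffun_on (mem Fam)) r.-1 ^ #|` P| <= _)%N.
  apply: leq_sum => E /ffun_onP EFam.
  have EP J : exists y, E J = positive_part (fun p => sarkaria p.2 (x p.1)) y.
    by have := EFam J; rewrite inE => /asboolP.
  have := card_family_le (fun t => card_allowed_colors t r0 EP).
  rewrite cardP; apply: leq_trans.
  rewrite sum1_card; apply/subset_leq_card/subsetP => color.
  move=> /andP[_ /eqP <-]; rewrite inE; apply/familyP => t; exact: (DP color).2.
rewrite sum_nat_const card_ffun_on card_ffun !card_ord.
by rewrite leq_mul2r leq_exp2r ?expn_gt0 ?s0 // Fam_card orbT.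
Qed.

(** * Point sets all of whose colourings are separated *)

Definition affine_form (R : realType) (d : nat) (f : 'rV[R]_d -> R) : Prop :=
  forall l x y, f (l *: x + (1 - l) *: y) = l * f x + (1 - l) * f y.

(** Every colouring of x admits a splitting lab of its classes into s pieces such
that any selection J of one piece per colour is separated by r closed halfspaces
with empty intersection.  The constant sum -1 makes the emptiness visible in the
functions, and survives the changes of coordinates below. *)
Definition avoiding (R : realType) (r d s : nat) (T : finType) (x : T -> 'rV[R]_d) :=
  injective x /\
  forall color : T -> 'I_r, exists lab : T -> 'I_s, forall J : 'I_r -> 'I_s,
  exists f : 'I_r -> 'rV[R]_d -> R,
    [/\ forall i, affine_form (f i), forall p, \sum_i f i p = -1 &
        forall t, lab t = J (color t) -> 0 <= f (color t) (x t)].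

(** The s-convex cover of class i is the union over its pieces j of the intersections
of all halfspaces made for a selection that takes piece j in class i. *)
Lemma avoiding_not_tverberg (R : realType) (r d s : nat) (T : finType)
    (x : T -> 'rV[R]_d) (M : nat) :
  avoiding r s x -> tverberg_property R d (fun _ : 'I_r => s) M -> (#|T| < M)%N.
Proof.
move=> [xinj av] tv; rewrite ltnNge; apply/negP => MT.
pose P := seq_fset tt [seq x t | t <- enum T].
have /tv[Q [[QP Qdis _] Qgood]] : (M <= #|` P|)%N.
  have xu : uniq [seq x t | t <- enum T] by rewrite map_inj_uniq // enum_uniq.
  by rewrite size_seq_fset undup_id // size_map -cardE.
have /choice[color colorP] t : exists i, Q i (x t).
  have : [set` P]%classic (x t) by rewrite /= seq_fsetE map_f ?mem_enum.
  by rewrite -QP => -[i _ Qi]; exists i.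
have [lab labP] := av color; have /choice[f fP] := labP.
pose K i j := [set p | forall J : 'I_r -> 'I_s, J i = j -> 0 <= f J i p]%classic.
have [||p Kp] := Qgood (fun i => \bigcup_j K i j)%classic.
- move=> i; exists (K i); split => // j p q l; rewrite !in_setE => Kp Kq J Jj.
  have [/(_ i) aff _ _] := fP J; rewrite /conv /= aff.
  by rewrite addr_ge0 // mulr_ge0 ?Kp ?Kq // subr_ge0.
- move=> i q Qq; have : [set` P]%classic q by rewrite -QP; exists i.
  rewrite /= seq_fsetE => /mapP[t _ qx]; exists (lab t) => // J Ji.
  have ti : color t = i.
    by apply: (Qdis _ _ I I); exists q; split => //; rewrite qx.
  by have [_ _ /(_ t)] := fP J; rewrite ti -qx; apply.
- have /choice[J JP] i : exists j, K i j p by have [j _ Kj] := Kp i I; exists j.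
  have [_ /(_ p) sf _] := fP J.
  have : 0 <= \sum_i f J i p by rewrite sumr_ge0 // => i _; apply: JP.
  by rewrite sf lerNr oppr0 ler10.
Qed.

(** * Copies of a point set along a parabola *)

(** The points (z t, h t) have one distinguished colour ord0, which stays in one
piece.  All separating halfspaces of the other colours lie below graphs of affine
functions, and on the distinguished class the gaps add up to at most -1. *)
Definition upper_avoiding (R : realType) (r d s : nat) (T : finType)
    (z : T -> 'rV[R]_d) (h : T -> R) :=
  injective (fun t => (z t, h t)) /\
  forall color : T -> 'I_r.+1, exists lab : T -> 'I_s, forall J : 'I_r -> 'I_s,
  exists a : 'I_r -> 'rV[R]_d -> R,
    [/\ forall i, affine_form (a i),
        forall t i, color t = lift ord0 i -> lab t = J i -> h t <= a i (z t) &
        forall t, color t = ord0 -> \sum_i (a i (z t) - h t) <= -1].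

(** At height 0 the inequality h <= a is the old separation, and colours ord0 and the
next one can be merged, since the separating functions sum to -1 everywhere. *)
Lemma avoiding_upper (R : realType) (r d s : nat) (T : finType) (x : T -> 'rV[R]_d) :
  (0 < r)%N -> avoiding r s x -> upper_avoiding r s x (fun=> 0).
Proof.
move=> r0 [xinj av]; split => [t t' [/xinj]//|color].
have [lab labP] := av (fun t => odflt (Ordinal r0) (unlift ord0 (color t))).
exists lab => J; have [f [faff fsum fpos]] := labP J.
exists f; split => // [t i ti tJ|t _].
  by have := fpos t; rewrite ti liftK; apply.
by under eq_bigr do rewrite subr0; rewrite fsum.
Qed.

(** With y the first coordinate of a point and m - n the distance between two copies,
the right-hand side is twice the factor of K in [relative_height_cluster]: it
stays away from 0 because L exceeds the width of a copy. *)
Lemma cluster_gap (R : realType) (L y : R) (m n : nat) :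
  1 <= L -> 4 * `|y| <= L -> m != n ->
  1 <= 2 * (L ^+ 2 * (m%:R - n%:R) ^+ 2 + 2 * L * (m%:R - n%:R) * y).
Proof.
move=> L1 yL mn; set k : R := m%:R - n%:R.
have k1 : 1 <= `|k|.
  rewrite /k; have [mn'|mn'] := leqP m n.
    by rewrite distrC -natrB // ger0_norm // ler1n subn_gt0 ltn_neqAle mn.
  by rewrite -natrB ?(ltnW mn') // ger0_norm // ler1n subn_gt0.
have ky : - (L * `|k|) <= 4 * (k * y).
  have : `|4 * (k * y)| <= L * `|k|.
    by rewrite !normrM ger0_norm // mulrCA [L * _]mulrC ler_wpM2l.
  by rewrite ler_norml => /andP[].
rewrite -(real_normK (num_real k)).
have L0 : 0 <= L by lra.
have h1 : 0 <= L * (4 * (k * y) + L * `|k|) by rewrite mulr_ge0 //; lra.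
have h2 : 0 <= L ^+ 2 * (`|k| * (`|k| - 1)).
  by rewrite !mulr_ge0 ?sqr_ge0 // subr_ge0.
have h3 : 1 <= (L * `|k|) ^+ 2 by rewrite exprn_ege1 // mulr_ege1.
by lra.
Qed.

(** Copy a is sheared so that its base points lie on a downward parabola of curvature
K over the first coordinate axis, at abscissa L a, with the tangent direction of
the parabola taken as horizontal. *)
Definition cluster_point (R : realType) (d : nat) (L K : R) (T : finType) (s : nat)
    (z : T -> 'rV[R]_d.+1) (h : T -> R) (p : T * 'I_s) : 'rV[R]_(1 + d.+1) :=
  let a := L * p.2%:R in
  row_mx (h p.1 - K * (a ^+ 2 + 2 * a * z p.1 0 ord0))%:M
    (z p.1 + a *: delta_mx 0 ord0).

Definition relative_position (R : realType) (d : nat) (L : R) (a : nat)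
    (X : 'rV[R]_(1 + d.+1)) : 'rV[R]_d.+1 :=
  rsubmx X - (L * a%:R) *: delta_mx 0 ord0.

(** The height above the tangent to the parabola at copy a. *)
Definition relative_height (R : realType) (d : nat) (L K : R) (a : nat)
    (X : 'rV[R]_(1 + d.+1)) : R :=
  lsubmx X 0 0 + K * (2 * (L * a%:R) * rsubmx X 0 ord0 - (L * a%:R) ^+ 2).

Lemma relative_position_cluster (R : realType) (d : nat) (L K : R) (T : finType)
    (s : nat) (z : T -> 'rV[R]_d.+1) (h : T -> R) (t : T) (b : 'I_s) a :
  relative_position L a (cluster_point L K z h (t, b)) =
  z t + (L * (b%:R - a%:R)) *: delta_mx 0 ord0.
Proof.
by rewrite /relative_position /cluster_point row_mxKr -addrA -scalerBl mulrBr.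
Qed.

Lemma relative_height_cluster (R : realType) (d : nat) (L K : R) (T : finType)
    (s : nat) (z : T -> 'rV[R]_d.+1) (h : T -> R) (t : T) (b : 'I_s) a :
  relative_height L K a (cluster_point L K z h (t, b)) =
  h t - K * (L ^+ 2 * (b%:R - a%:R) ^+ 2 + 2 * L * (b%:R - a%:R) * z t 0 ord0).
Proof.
rewrite /relative_height /cluster_point row_mxKl row_mxKr !mxE !eqxx /=.
by ring.
Qed.

Lemma affine_relative (R : realType) (d : nat) (L K : R) (a : nat)
    (f : 'rV[R]_d.+1 -> R) :
  affine_form f ->
  affine_form (fun X => f (relative_position L a X) - relative_height L K a X).
Proof.
move=> faff l X Y.
have -> : relative_position L a (l *: X + (1 - l) *: Y) =
    l *: relative_position L a X + (1 - l) *: relative_position L a Y.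
  by apply/rowP => i; rewrite /relative_position !mxE; ring.
by rewrite faff /relative_height !mxE; ring.
Qed.

(** Colour ord0 is split by copies, the other colours as prescribed inside each copy.
A selection J takes the piece of ord0 lying in copy a := J ord0 and is separated in
the coordinates of that copy; the points of the other copies lie so far below its
tangent that all halfspaces of the colours other than ord0 contain them.  The
function of ord0 is determined by the sum -1. *)
Lemma avoiding_clusters (R : realType) (r d s : nat) (T : finType)
    (z : T -> 'rV[R]_d.+1) (h : T -> R) :
  upper_avoiding r s z h ->
  exists x : T * 'I_s -> 'rV[R]_(1 + d.+1), avoiding r.+1 s x.
Proof.
move=> [zinj up].
have /fin_all_exists[lab labP] (c : {ffun T -> 'I_r.+1}) := up c.
have /fin_all_exists[al alP] (p : {ffun T -> 'I_r.+1} * {ffun 'I_r -> 'I_s}) :=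
  labP p.1 p.2.
have [L0 L00 L0P] := finite_ubound (fun t => 4 * `|z t 0 ord0|).
pose L := L0 + 1; have L1 : 1 <= L by rewrite lerDr ltW.
have LP t : 4 * `|z t 0 ord0| <= L by rewrite ler_wpDr.
have [K K0 KP] := finite_ubound
  (fun p : (({ffun T -> 'I_r.+1} * {ffun 'I_r -> 'I_s}) * 'I_r) * (T * ('I_s * 'I_s)) =>
     2 * (h p.2.1 - al p.1.1 p.1.2
       (z p.2.1 + (L * (p.2.2.1%:R - p.2.2.2%:R)) *: delta_mx 0 ord0))).
exists (cluster_point L K z h); split.
  move=> [t b] [t' b'] E.
  have := congr1 (fun X => relative_position L 0 X 0 ord0) E.
  rewrite /= !relative_position_cluster !mxE !eqxx /= !subr0 => E1.
  have bb' : b = b'.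
    apply/val_inj/eqP; apply: contraT => nbb'.
    have := LP t; have := LP t'; have k1 : 1 <= `|b%:R - b'%:R : R|.
      have [bb'|bb'] := leqP b b'.
        by rewrite distrC -natrB // ger0_norm // ler1n subn_gt0 ltn_neqAle nbb'.
      by rewrite -natrB ?(ltnW bb') // ger0_norm // ler1n subn_gt0.
    have E2 : L * (b%:R - b'%:R) = z t' 0 ord0 - z t 0 ord0 by move: E1; lra.
    have : L <= `|z t' 0 ord0 - z t 0 ord0|.
      by rewrite -E2 normrM ger0_norm ?ler_peMr //; lra.
    by have := ler_normB (z t' 0 ord0) (z t 0 ord0); lra.
  rewrite -{b'}bb' in E E1 *; congr (_, _); apply: zinj; congr (_, _).
    have := congr1 (relative_position L b) E.
    by rewrite !relative_position_cluster subrr mulr0 scale0r !addr0.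
  have := congr1 (relative_height L K b) E.
  by rewrite !relative_height_cluster subrr expr0n /= !(mulr0, mul0r) addr0 mulr0 !subr0.
move=> color; pose c b := [ffun t => color (t, b)].
exists (fun p => if color p == ord0 then p.2 else lab (c p.2) p.1) => J.
pose a := J ord0; pose J' := [ffun i => J (lift ord0 i)].
have [aff own sep] := alP (c a, J').
(* Own copy: the given separation.  Another copy: [cluster_gap] and the choice of K. *)
pose F i X := al (c a, J') i (relative_position L a X) - relative_height L K a X.
exists (fun k X => oapp (F^~ X) (-1 - \sum_i F i X) (unlift ord0 k)); split.
- have Faff i : affine_form (F i) by apply: affine_relative.
  move=> k; case: (unliftP ord0 k) => [i|] _ //= l X Y.
  by under eq_bigr do rewrite Faff; rewrite big_split /= -!mulr_sumr; ring.
- move=> X; rewrite big_ord_recl unlift_none /=.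
  by under [X in _ + X]eq_bigr do rewrite liftK /=; ring.
- move=> [t b] /=; case: (unliftP ord0 (color (t, b))) => [i|] ci.
    rewrite ci eq_sym (negbTE (neq_lift _ _)) /= /F => tJ.
    rewrite relative_position_cluster relative_height_cluster subr_ge0.
    have [ba|ba] := eqVneq b a.
      rewrite ba subrr expr0n /= !(mulr0, mul0r) addr0 mulr0 !subr0 scale0r addr0.
      by apply: own; rewrite ffunE -ba // tJ.
    have := KP (((c a, J'), i), (t, (b, a))) => /=.
    have := cluster_gap L1 (LP t) ba; set G := _ + _; set Y := al _ _ _.
    by nra.
  rewrite ci eqxx /= => ba.
  have := sep t; rewrite ffunE -[a]ba ci => /(_ erefl).
  rewrite -lerN2 opprK -subr_ge0 => /le_trans; apply.
  rewrite addrC lerD2l lerN2; apply: ler_sum => i _; rewrite /F.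
  rewrite relative_position_cluster relative_height_cluster -[a]ba.
  by rewrite subrr expr0n /= !(mulr0, mul0r) addr0 mulr0 !subr0 scale0r addr0.
Qed.

(** * Ellipses shattered by few points *)

Lemma sqr_ge_of_norm (R : realType) (a x : R) : 0 <= a -> a <= `|x| -> a ^+ 2 <= x ^+ 2.
Proof. by move=> a0 ax; rewrite -(real_normK (num_real x)) lerXn2r // nnegrE. Qed.

Lemma sqr_le_of_norm (R : realType) (a x : R) : `|x| <= a -> x ^+ 2 <= a ^+ 2.
Proof.
move=> xa; rewrite -(real_normK (num_real x)) lerXn2r // nnegrE //.
exact: le_trans xa.
Qed.

Definition ellipse_form (R : realType) (e : R * R * R * R) (u w : R) : R :=
  let: (a, be, b, rho) := e in rho - (u - a) ^+ 2 - be * (w - b) ^+ 2.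

(** Every set A of ellipses is met exactly by one point (u j, y) from each horizontal
strip; the ordinate y is free within the strip, and this freedom is what allows the
next step of the recursion to subdivide the strips. *)
Definition hits_all_subsets (R : realType) (T S : finType) (e : T -> R * R * R * R)
    (w : S -> R) (eta K : R) : Prop :=
  forall A : {set T}, exists u : S -> R,
    [/\ forall j, `|u j| <= K,
        forall t, t \in A -> exists j, forall y, `|y - w j| <= eta ->
          0 <= ellipse_form (e t) (u j) y &
        forall t, t \notin A -> forall j y, `|y - w j| <= eta ->
          ellipse_form (e t) (u j) y <= -1].

(** Recursion of Pach and Tardos: take two copies of the system side by side, halve
each strip, and add for every strip j one flat ellipse that covers the lower half
of j over the first copy.  Strip j now contains one point of each copy, and one of
them goes to the lower half, the other one to the upper half: the point of the
first copy goes down exactly if the new ellipse of j is to be hit. *)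
Lemma ellipse_system_exists (R : realType) (m : nat) :
  exists (T S : finType) (e : T -> R * R * R * R) (w : S -> R) (eta K : R),
    [/\ #|T| = (m * 2 ^ m.-1)%N /\ #|S| = (2 ^ m)%N,
        0 < eta /\ 1 <= K,
        forall t, 0 <= (e t).1.1.2,
        forall j j', j != j' -> 4 * eta <= `|w j - w j'| &
        hits_all_subsets e w eta K].
Proof.
elim: m => [|m [T [S [e [w [eta [K [[cT cS] [eta0 K1] be0 sepw hits]]]]]]]].
  exists void, unit, (@of_void _), (fun=> 0), 1, 1; split.
  - by rewrite card_void card_unit.
  - by rewrite ltr01 lexx.
  - by case.
  - by move=> [] [].
  - by move=> A; exists (fun=> 0); split => [j|[]|[]]; rewrite normr0.
have [L0 L00 L0P] := finite_ubound (fun t => K + `|(e t).1.1.1| + `|(e t).2| + 1).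
(* L shifts the second copy beyond the reach of the first one; at width eta / 8 the
   two halves of a strip leave room around each other. *)
pose L := L0 + 3 * K; pose eta' := eta / 8.
have eta'0 : 0 < eta' by rewrite divr_gt0.
have e8 : eta = 8 * eta' by rewrite /eta'; field.
clearbody eta'.
pose e' (t : bool * T + S) := match t with
  | inl (c, t) => ((e t).1.1.1 + c%:R * L, (e t).1.1.2, (e t).1.2, (e t).2)
  | inr j => (0, (K / eta') ^+ 2, w j, 2 * K ^+ 2) end.
pose w' (p : bool * S) := w p.2 + p.1%:R * (eta / 2).
have K0 : 0 < K by apply: lt_le_trans K1.
have w'_near p : `|w' p - w p.2| <= 4 * eta'.
  rewrite /w' addrC addKr; case: p => [[] j] /=; last by rewrite mul0r normr0; lra.
  by rewrite mul1r ger0_norm; lra.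
have far_w j p y : (j != p.2) || p.1 -> `|y - w' p| <= eta' -> 3 * eta' <= `|y - w j|.
  move=> jp yp; have [E|ne] := eqVneq j p.2.
    move: jp yp; rewrite E eqxx /= /w' => ->.
    rewrite mul1r ler_norml ler_normr => /andP[y1 _]; apply/orP; left; lra.
  have := sepw _ _ ne; have := w'_near p.
  have := ler_distD y (w j) (w p.2); have := ler_distD (w' p) y (w p.2).
  by rewrite (distrC (w j) y); lra.
exists (bool * T + S)%type, (bool * S)%type, e', w', eta', (K + L); split.
- rewrite card_sum !card_prod card_bool cT cS /= expnS; split => //.
  by case: (m) => [|k] //=; rewrite expnS; lia.
- by split => //; rewrite /L; lra.
- by move=> [[c t]|j] //=; rewrite sqr_ge0.
- move=> [c j] [c' j']; rewrite xpair_eqE negb_and => ne.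
  have [E|nj] := eqVneq j j'.
    have -> : w' (c, j) - w' (c', j') = (c%:R - c'%:R) * (eta / 2).
      by rewrite /w' /= E; ring.
    have e2 : `|eta / 2| = eta / 2 by rewrite ger0_norm //; lra.
    rewrite normrM e2.
    move: ne; rewrite E eqxx orbF; case: c c' => [] [] //= _.
      by rewrite subr0 normr1; lra.
    by rewrite sub0r normrN normr1; lra.
  have := sepw _ _ nj; have := w'_near (c, j); have := w'_near (c', j') => /=.
  have := ler_distD (w' (c, j)) (w j) (w j').
  have := ler_distD (w' (c', j')) (w' (c, j)) (w j').
  by rewrite (distrC (w j) (w' _)); lra.
move=> A.
have /choice[u uP] (c : bool) := hits [set t | inl (c, t) \in A].
(* The half p.1 of strip p.2 receives the point of this copy. *)
pose copy (p : bool * S) : bool := p.1 (+) (inr p.2 \notin A).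
exists (fun p => u (copy p) p.2 + (copy p)%:R * L); split.
- move=> p; have [/(_ p.2) uK _ _] := uP (copy p).
  apply: le_trans (ler_normD _ _) _; apply: lerD => //.
  by case: (copy p); rewrite ?mul1r ?mul0r ?normr0 ?ger0_norm /L; lra.
- move=> [[c t]|j] tA.
    have [_ /(_ t) + _] := uP c; rewrite inE => /(_ tA)[j jP].
    exists (c (+) (inr j \notin A), j) => y.
    rewrite /copy /= -addbA addbb addbF => yw.
    rewrite /= opprD addrACA subrr addr0; apply: le_trans (jP y _) _.
      have := w'_near (c (+) (inr j \notin A), j) => /=.
      by have := ler_distD (w' (c (+) (inr j \notin A), j)) y (w j); lra.
    by case: (e t) => [[[]]].
  exists (false, j) => y; rewrite /copy /= tA /= /w' /= mul0r !addr0 => yw.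
  have [/(_ j) uK _ _] := uP false.
  have := sqr_le_of_norm uK; have := sqr_le_of_norm yw.
  rewrite mul0r addr0 subr0 expr_div_n => yw2 uK2.
  have : K ^+ 2 / eta' ^+ 2 * (y - w j) ^+ 2 <= K ^+ 2.
    rewrite mulrAC ler_pdivrMr ?exprn_gt0 //.
    by apply: ler_wpM2l => //; exact: sqr_ge0.
  by lra.
- move=> [[c t]|j] tA [ch j'] y yw.
    have [cc|cc] := eqVneq (copy (ch, j')) c.
      have [_ _ /(_ t)] := uP c; rewrite inE => /(_ tA j' y) qt.
      rewrite cc /= opprD addrACA subrr addr0; apply: le_trans (qt _).
        by case: (e t) => [[[]]].
      have := w'_near (ch, j') => /=.
      by have := ler_distD (w' (ch, j')) y (w j'); lra.
    have [/(_ j') uK _ _] := uP (copy (ch, j')).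
    rewrite /=; have := L0P t; have := be0 t; set U := u _ _ in uK *.
    case: (e t) => [[[a be] b] rho] /= be1 L0t.
    have bey : 0 <= be * (y - b) ^+ 2 by rewrite mulr_ge0 ?sqr_ge0.
    have dist : 1 + `|rho| <= `|U + (copy (ch, j'))%:R * L - (a + c%:R * L)|.
      rewrite ler_normr; have := ler_norm a; have := ler_norm (- a).
      rewrite normrN; move: uK; rewrite ler_norml => /andP[U1 U2] a1 a2.
      move: cc; case: (c) (copy _) => [] [] //= _; apply/orP;
        [right|left]; rewrite /L; lra.
    have := sqr_ge_of_norm _ dist; have := ler_norm rho; have := normr_ge0 rho.
    move=> r1 r2 /(_ ltac:(lra)).
    have := sqr_ge0 `|rho|; lra.
  have [|near_j] := boolP ((j != j') || ch).
    move=> far; have := sqr_ge_of_norm _ (far_w j (ch, j') y far yw).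
    move=> /(_ ltac:(lra)) => yw2.
    have : 9 * K ^+ 2 <= (K / eta') ^+ 2 * (y - w j) ^+ 2.
      rewrite expr_div_n mulrAC ler_pdivlMr ?exprn_gt0 //.
      by have := sqr_ge0 K; nra.
    rewrite /=; set X := (X in _ - X ^+ 2 - _); have := sqr_ge0 X.
    have : 1 <= K ^+ 2 by nra.
    by lra.
  move: near_j; rewrite negb_or negbK => /andP[/eqP jj' /negbTE chf].
  rewrite /copy /= chf -jj' tA /= mul1r subr0.
  have [/(_ j) uK _ _] := uP true.
  have : 2 * K <= `|u true j + L|.
    rewrite ler_normr; move: uK; rewrite ler_norml => /andP[U1 U2].
    by apply/orP; left; rewrite /L; lra.
  move/sqr_ge_of_norm => /(_ ltac:(lra)).
  have : 0 <= (K / eta') ^+ 2 * (y - w j) ^+ 2 by rewrite mulr_ge0 ?sqr_ge0.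
  have : 1 <= K ^+ 2 by nra.
  rewrite exprMn; lra.
Qed.

(** * Avoiding sets of every rank *)

Definition parameter_point (R : realType) (e : R * R * R * R) : 'rV[R]_3 :=
  let: (a, be, b, _) := e in
  \row_(i < 3) [:: a; be; be * b]`_i.

Definition parameter_height (R : realType) (e : R * R * R * R) : R :=
  let: (a, be, b, rho) := e in a ^+ 2 + be * b ^+ 2 - rho.

(** Expanded in the parameters of an ellipse, its form at (u, w) is affine, with the
parameter height entering with coefficient -1: [location_formE]. *)
Definition location_form (R : realType) (u w : R) (z : 'rV[R]_3) : R :=
  2 * u * z 0 0 - w ^+ 2 * z 0 1 + 2 * w * z 0 ord_max - u ^+ 2.

Lemma affine_location (R : realType) (u w : R) : affine_form (location_form u w).
Proof. by move=> l x y; rewrite /location_form !mxE; ring. Qed.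

Lemma location_formE (R : realType) (u w : R) (e : R * R * R * R) :
  location_form u w (parameter_point e) - parameter_height e = ellipse_form e u w.
Proof.
case: e => [[[a be] b] rho]; rewrite /location_form /parameter_point !mxE /=.
by ring.
Qed.

(** Injectivity follows from the exact hitting: two ellipses with the same parameters
could not be told apart by any set of points. *)
Lemma upper_avoiding_ellipses (R : realType) (m s : nat) :
  (2 ^ m <= s)%N ->
  exists (T : finType) (z : T -> 'rV[R]_3) (h : T -> R),
    #|T| = (m * 2 ^ m.-1)%N /\ upper_avoiding 1 s z h.
Proof.
move=> ms.
have [T [S [e [w [eta [K [[cT cS] [eta0 _] _ _ hits]]]]]]] :=
  ellipse_system_exists R m.
have /card_gt0P[j0 _] : (0 < #|S|)%N by rewrite cS expn_gt0.
have near_w j : `|w j - w j| <= eta by rewrite subrr normr0 ltW.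
exists T, (fun t => parameter_point (e t)), (fun t => parameter_height (e t)).
split=> //; split=> [t t' [zt ht]|color].
  have [u [_ hit miss]] := hits [set t].
  apply/eqP; apply: contraT => tt'.
  have [j /(_ _ (near_w j))] := hit t (set11 t).
  rewrite -location_formE zt ht location_formE.
  have t't : t' \notin [set t] by rewrite inE eq_sym.
  by have := miss t' t't j _ (near_w j); lra.
have [u [_ hit miss]] := hits [set t | color t != ord0].
have s0 : (0 < s)%N by apply: leq_trans ms; rewrite expn_gt0.
pose pt (l : 'I_s) := nth j0 (enum S) l.
have /choice[lab labP] t : exists l : 'I_s, color t != ord0 ->
    0 <= ellipse_form (e t) (u (pt l)) (w (pt l)).
  have [t0|t1] := boolP (color t == ord0).
    by exists (Ordinal s0).
  have [|j /(_ _ (near_w j)) jP] := hit t; first by rewrite inE.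
  have js : (enum_rank j < s)%N by apply: leq_trans (ltn_ord _) _; rewrite cS.
  by exists (Ordinal js) => _; rewrite /pt /= nth_enum_rank.
exists lab => J; exists (fun i => location_form (u (pt (J i))) (w (pt (J i)))).
split => [i|t i ti tJ|t t0]; first exact: affine_location.
  rewrite -subr_ge0 location_formE -tJ; apply: labP.
  by rewrite ti eq_sym neq_lift.
rewrite big_ord1 location_formE; apply: miss => //.
by rewrite inE t0 eqxx.
Qed.

Definition avoiding_set_of_size (R : realType) (r d s n : nat) : Prop :=
  exists (T : finType) (x : T -> 'rV[R]_d), #|T| = n /\ avoiding r s x.

Lemma avoiding_set_cluster (R : realType) (r d s n : nat) :
  (0 < r)%N -> avoiding_set_of_size R r d.+1 s n ->
  avoiding_set_of_size R r.+1 d.+2 s (n * s).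
Proof.
move=> r0 [T [x [cT av]]].
have [y yav] := avoiding_clusters (avoiding_upper r0 av).
by exists (T * 'I_s)%type, y; rewrite card_prod card_ord cT.
Qed.

Lemma avoiding_set_widen (R : realType) (r d s n : nat) :
  avoiding_set_of_size R r d s n -> avoiding_set_of_size R r d.+1 s n.
Proof.
move=> [T [x [cT [xinj av]]]].
exists T, (fun t => row_mx (0 : 'rV_1) (x t) : 'rV_(1 + d)); split=> //; split.
  by move=> t t' /(@eq_row_mx _ _ 1 d)[_ /xinj].
move=> color; have [lab labP] := av color; exists lab => J.
have [f [faff fsum fpos]] := labP J.
exists (fun i (X : 'rV_(1 + d)) => f i (rsubmx X)); split=> //.
  by move=> i l X Y; rewrite !linearD !linearZ; apply: faff.
by move=> t tJ; rewrite row_mxKr fpos.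
Qed.

Lemma avoiding_set_exists (R : realType) (r e m s : nat) :
  (2 ^ m <= s)%N ->
  avoiding_set_of_size R r.+2 (e + r.+4) s (m * 2 ^ m.-1 * s ^ r.+1).
Proof.
move=> ms; elim: e => [|e IHe]; last exact: avoiding_set_widen.
elim: r => [|r IHr].
  have [T [z [h [cT up]]]] := upper_avoiding_ellipses R ms.
  have [x xav] := avoiding_clusters up.
  by exists (T * 'I_s)%type, x; rewrite card_prod card_ord cT expn1.
by rewrite expnSr mulnA; apply: avoiding_set_cluster.
Qed.

(** * Logarithmic estimates *)

Lemma ln_le_subr1 (R : realType) (x : R) : 0 < x -> ln x <= x - 1.
Proof.
move=> x0; have -> : ln x = ln (1 + (x - 1)) by rewrite addrC subrK.
by apply: le_ln1Dx; lra.
Qed.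

Lemma ln_natr_ge_half (R : realType) (s : nat) : (2 <= s)%N -> 2^-1 <= ln (s%:R : R).
Proof.
move=> s2; have s0 : 0 < (s%:R : R) by rewrite ltr0n; lia.
have : ln (s%:R^-1 : R) <= s%:R^-1 - 1 by rewrite ln_le_subr1 ?invr_gt0.
rewrite lnV ?posrE //.
have : (s%:R^-1 : R) <= 2^-1 by rewrite lef_pV2 ?posrE // ler_nat.
by lra.
Qed.

(** With m = n / y, the claim is D r (ln (2 r) + ln m + r l) < m.  The choice
K = 4 r D bounds ln m by m / K + K, the hypothesis bounds l by a multiple of m,
and each of the three contributions is at most m / 4. *)
Lemma certificates_beat_entropy (R : realType) (r D y l n : R) :
  1 <= r -> 1 <= D -> 0 < y -> 2^-1 <= l -> ln y = r * l ->
  8 * r * D * (2 * r + 4 * r * D) * (y * l) <= n ->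
  D * y * ln (2 * r * n) < n / r.
Proof.
move=> r1 D1 y0 l12 lny nC.
pose m := n / y; have nE : n = m * y by rewrite /m divfK // gt_eqF.
have r0 : 0 < r by lra.
have D0 : 0 < D by lra.
have rD0 : 0 < r * D by rewrite mulr_gt0.
have mC : 8 * r * D * (2 * r + 4 * r * D) * l <= m.
  by rewrite /m ler_pdivlMr //; move: nC; rewrite mulrA [_ * y * l]mulrAC.
clearbody m.
have m0 : 0 < m.
  by apply: lt_le_trans mC; rewrite !mulr_gt0 //; [nra | lra].
pose K := 4 * r * D; have K0 : 0 < K by rewrite /K -mulrA mulr_gt0.
have lnm : ln m <= m / K + K.
  have : ln (m / K) <= m / K - 1 by apply: ln_le_subr1; apply: divr_gt0.
  rewrite lnM ?posrE ?invr_gt0 // lnV ?posrE //.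
  by have := ln_sublinear K0; lra.
have lnr : ln (2 * r) <= 2 * r by apply/ltW/ln_sublinear; lra.
have lnn : ln (2 * r * n) = ln (2 * r) + (ln m + r * l).
  have r20 : 0 < 2 * r by lra.
  have l1 : ln (2 * r * (m * y)) = ln (2 * r) + ln (m * y).
    by apply: lnM; rewrite posrE ?mulr_gt0.
  by rewrite nE l1 [ln (m * y)]lnM ?posrE // lny.
rewrite ltr_pdivlMr // lnn nE; set S := _ + _.
have -> : D * y * S * r = (D * r * S) * y by ring.
rewrite ltr_pM2r // {}/S.
have b1 : 8 * (D * r * (2 * r + K)) * l <= m by move: mC; rewrite -/K; nra.
have b2 : 4 * (D * r * (2 * r + K)) <= m.
  apply: le_trans b1; have : 0 < D * r * (2 * r + K).
    by rewrite !mulr_gt0 // addr_gt0 // mulr_gt0.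
  by nra.
have b3 : 4 * (D * r * (r * l)) <= m.
  have : 0 <= D * r * l * K by rewrite !mulr_ge0 // ltW //; lra.
  have : 0 <= D * r * l * r by rewrite !mulr_ge0 // ltW //; lra.
  by move: b1; nra.
have b4 : D * r * (m / K) = m / 4 by rewrite /K; field; rewrite !gt_eqF.
have : D * r * (ln (2 * r) + (ln m + r * l)) <= D * r * (2 * r + (m / K + K + r * l)).
  by apply: ler_wpM2l; [rewrite mulr_ge0 ?ltW | lra].
by nra.
Qed.

Lemma count_of_large (R : realType) (r d s n : nat) :
  (2 <= r)%N -> (2 <= s)%N ->
  8 * r%:R * (r * (d + 1))%:R * (2 * r%:R + 4 * r%:R * (r * (d + 1))%:R) *
    (s%:R ^+ r * ln (s%:R : R)) <= n%:R ->
  (((n * r).+1 ^ (r * (d + 1))) ^ (s ^ r) * r.-1 ^ n < r ^ n)%N.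
Proof.
move=> r2 s2 nC.
have rn0 : (0 < r)%N := ltnW r2.
have rn1 : (0 < r.-1)%N by rewrite -ltnS prednK.
have r1 : 1 <= (r%:R : R) by rewrite ler1n.
have r0 : 0 < (r%:R : R) by lra.
have D1 : 1 <= ((r * (d + 1))%:R : R) by rewrite ler1n muln_gt0 rn0 addn1.
have s0 : 0 < (s%:R : R) by rewrite ltr0n ltnW.
have l12 := ln_natr_ge_half R s2.
have y0 : 0 < (s%:R ^+ r : R) by rewrite exprn_gt0.
have n0 : 0 < (n%:R : R).
  apply: lt_le_trans nC; rewrite !mulr_gt0 //; try lra.
  by rewrite addr_gt0 // mulr_gt0 //; lra.
have main := certificates_beat_entropy r1 D1 y0 l12 _ nC.
have {}main := main ltac:(by rewrite lnXn // mulr_natl).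
rewrite -(ltr_nat R) natrM !natrX -ltr_ln ?posrE; last 2 first.
- by rewrite mulr_gt0 ?exprn_gt0 // ltr0n.
- by rewrite exprn_gt0.
have r'0 : 0 < (r.-1%:R : R) by rewrite ltr0n.
rewrite lnM ?posrE ?exprn_gt0 // !lnXn ?exprn_gt0 //.
rewrite -mulrnA -!(mulr_natl (ln _)).
have lnr : ln (r.-1%:R : R) <= ln r%:R - r%:R^-1.
  have : ln (r.-1%:R / r%:R : R) <= r.-1%:R / r%:R - 1.
    by rewrite ln_le_subr1 // divr_gt0.
  rewrite lnM ?posrE ?invr_gt0 // lnV ?posrE //.
  have -> : (r.-1%:R / r%:R : R) = 1 - r%:R^-1.
    have -> : (r.-1%:R : R) = r%:R - 1 by rewrite -subn1 natrB.
    by field; rewrite gt_eqF.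
  by lra.
have nr : ln ((n * r).+1%:R : R) <= ln (2 * r%:R * n%:R).
  rewrite ler_ln ?posrE ?ltr0n //; last by rewrite !mulr_gt0.
  rewrite -!natrM ler_nat -mulnA mul2n -addnn [(r * n)%N]mulnC -addn1 leq_add2l.
  by rewrite muln_gt0 -(ltr0n R) n0 rn0.
have := ler_wpM2l (ltW n0) lnr; rewrite mulrBr => h1.
have h2 : ((r * (d + 1)) * s ^ r)%:R * ln ((n * r).+1%:R : R) <=
    (r * (d + 1))%:R * s%:R ^+ r * ln (2 * r%:R * n%:R).
  by rewrite natrM natrX ler_wpM2l // mulr_ge0 ?ltW //; lra.
by lra.
Qed.

Lemma dyadic_size_bound (R : realType) (s : nat) : (2 <= s)%N ->
  exists2 m, (2 ^ m <= s)%N & s%:R * ln (s%:R : R) <= 8 * (m * 2 ^ m.-1)%:R.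
Proof.
move=> s2; have /andP[ms sm] := trunc_log_bounds (isT : (1 < 2)%N) (ltnW s2).
set m := trunc_log 2 s in ms sm; exists m => //.
have m0 : (0 < m)%N by case: (m) sm => //; lia.
have s0 : 0 < (s%:R : R) by rewrite ltr0n; lia.
have lns : ln (s%:R : R) <= (2 * m)%:R.
  have : ln (s%:R : R) <= ln ((2 ^ m.+1)%:R).
    by rewrite ler_ln ?posrE ?ltr0n ?expn_gt0 ?ler_nat //; lia.
  rewrite natrX lnXn // => /le_trans; apply.
  have ln2 : ln (2 : R) <= 1 by have := @ln_le_subr1 R 2 ltac:(lra); lra.
  apply: le_trans (_ : m.+1%:R <= _); last by rewrite ler_nat; lia.
  exact: ler_wMn2r.
have sle : (s%:R : R) <= (4 * 2 ^ m.-1)%:R.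
  by rewrite ler_nat; move: sm; case: (m) m0 => //= k _; rewrite !expnS; lia.
apply: le_trans (ler_pM _ _ sle lns) _ => //.
  by have := ln_natr_ge_half R s2; lra.
by rewrite -!natrM ler_nat; lia.
Qed.

(** * The order of magnitude *)

Theorem mainTheorem7 (R : realType) (r d : nat) (hr : (2 <= r)%N)
    (hd : (r + 2 <= d)%N) :
  exists (c C : R) (s0 : nat),
    0 < c /\ 0 < C /\
    forall s : nat, (s0 <= s)%N ->
      exists N : nat,
        is_tverberg_number R d (fun _ : 'I_r => s) N /\
        c * (s%:R ^+ r * ln (s%:R : R)) <= N%:R /\
        N%:R <= C * (s%:R ^+ r * ln (s%:R : R)).
Proof.
pose C0 : R := 8 * r%:R * (r * (d + 1))%:R * (2 * r%:R + 4 * r%:R * (r * (d + 1))%:R).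
have C00 : 0 <= C0 by rewrite !mulr_ge0 ?addr_ge0 ?mulr_ge0.
exists 8^-1, (C0 + 1), 2%N; split; first by rewrite invr_gt0.
split=> [|s s2]; first by rewrite ltr_pwDr.
set Y := s%:R ^+ r * ln s%:R.
have l12 := ln_natr_ge_half R s2.
have Y1 : 1 <= Y.
  have : 2 <= (s%:R ^+ r : R).
    rewrite -natrX ler_nat (leq_trans s2) // -{1}[s]expn1 leq_exp2l //; lia.
  by rewrite /Y; nra.
have [N0 /andP[N0l N0u]] : exists k : nat, k%:R <= C0 * Y < k.+1%:R.
  by eexists; apply: truncn_itv; rewrite mulr_ge0 //; lra.
have tv0 : tverberg_property R d (fun _ : 'I_r => s) N0.+1.
  apply: tverberg_property_of_count; [lia | lia |] => n N0n.
  apply: (@count_of_large R) => //; apply: le_trans (ltW N0u) _.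
  by rewrite ler_nat.
pose has_tv N := `[< tverberg_property R d (fun _ : 'I_r => s) N >].
have ex_tv : exists N, has_tv N by exists N0.+1; apply/asboolP.
case: (ex_minnP ex_tv) => N /asboolP tvN minN.
exists N; split; first by split=> // M tvM; apply: minN; apply/asboolP.
split; last first.
  have : (N%:R : R) <= N0.+1%:R by rewrite ler_nat minN //; apply/asboolP.
  by rewrite -addn1 natrD mulrDl mul1r; lra.
have [m ms sm] := dyadic_size_bound R s2.
have [T [x [cT av]]] : avoiding_set_of_size R r d s (m * 2 ^ m.-1 * s ^ r.-1).
  have -> : r = r.-2.+2 by lia.
  have -> : d = ((d - r.-2.+4) + r.-2.+4)%N by lia.
  exact: avoiding_set_exists.
have := avoiding_not_tverberg av tvN; rewrite cT => TN.
apply: le_trans (_ : (m * 2 ^ m.-1 * s ^ r.-1)%:R <= _); last by rewrite ler_nat ltnW.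
rewrite natrM natrX /Y.
have -> : (s%:R ^+ r : R) = s%:R * s%:R ^+ r.-1 by rewrite -exprS prednK //; lia.
have := ler_wpM2r (exprn_ge0 r.-1 (ler0n R s)) sm.
by lra.
Qed.
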